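(* Let $F$ be a CNF formula and let $M=(\ell_{i,j})$ be an $n\times m$ matrix of pairwise distinct literals of $F$ that exhibits row symmetry in $F$. Suppose that for every column $j\in[1,m]$ the clause $C_j:=\{\ell_{i,j}\}_{i\in[1,n]}$ belongs to $F$ and is a unique literal clause with respect to $F$. Let $L$ be the set of unit clauses consisting of $\{\ell_{n,1}\}$ together with $\{\overline{\ell_{i,j}}\}$ for every $j\in[1,\min(n,m)]$ and every $i\le n-j$ (orbitopal fixing). Then: (1) $F$ and $F\wedge L$ are equisatisfiable; (2) there exists an SR proof that adds the unit clauses of $L$ to $F$ in the following order: column-wise, from the leftmost column to the right, and within each column from top (row $1$) to bottom.
   Context: A literal is a variable $v$ or its negation $\overline v$; a clause is a set (disjunction) of literals; a CNF formula is a set (conjunction) of clauses. $\mathrm{Var}(F)$ and $\mathrm{Lit}(F)$ denote the variables and literals occurring in $F$ (literal sets are taken closed under negation where needed for permutations). Two formulas are equisatisfiable if one is satisfiable iff the other is. A clause $C\in F$ is a unique literal clause (ULC) with respect to $F$ if none of its literals occurs in any clause of $F\setminus\{C\}$. A (syntactic) symmetry of $F$ is a permutation $\sigma$ of the literals of $F$ such that $\sigma(F)=F$ (relabeling every literal of every clause by $\sigma$ yields the same set of clauses) and $\sigma(\overline\ell)=\overline{\sigma(\ell)}$ for all literals $\ell$. $\mathrm{Aut}(F)$ is the group of symmetries of $F$. An $n\times m$ matrix $M=(\ell_{i,j})$ of literals of $F$ exhibits row symmetry in $F$ if for all $i_1,i_2\in[1,n]$ there is $\sigma_{i_1,i_2}\in\mathrm{Aut}(F)$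 with $\sigma_{i_1,i_2}(\ell_{i_1,j})=\ell_{i_2,j}$, $\sigma_{i_1,i_2}(\ell_{i_2,j})=\ell_{i_1,j}$ for all $j\in[1,m]$, and $\sigma_{i_1,i_2}(\ell_{i,j})=\ell_{i,j}$ for all $i\notin\{i_1,i_2\}$ and all $j$; its action on literals outside $M$ is unrestricted. Substitution redundancy: a substitution is a map $\omega$ from $\mathrm{Var}(F)$ to literals of $F$ or the constants $\top,\bot$, extended to literals by $\omega(\overline v)=\overline{\omega(v)}$ (with $\overline\top=\bot$, $\overline\bot=\top$). For a formula $G$, $G_{|\omega}$ is obtained by replacing each literal $\ell$ by $\omega(\ell)$, deleting clauses containing $\top$ and deleting occurrences of $\bot$. For a clause $C$, $\neg C:=\bigwedge_{\ell\in C}\overline\ell$. $G\vdash_1\bot$ means unit propagation on $G$ yields a conflict (empty clause); $G\vdash_1 D$ for a clause $D$ means $G\wedge\neg D\vdash_1\bot$; $G\vdash_1 H$ for a formula $H$ means $G\vdash_1 D$ for every $D\in H$. A clause $C$ is substitution redundant (SR) for $G$ if there is a substitution $\omega$ with $G\wedge\neg C\vdash_1 (G\wedge C)_{|\omega}$. An SR proof adding clauses $D_1,\dots,D_r$ to $F$ is a sequence of these additions in which each $D_t$ is SR for $F\wedge D_1\wedge\dots\wedge D_{t-1}$.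
   Formalization: Added hypothesis: no two entries of M that L sets to false are complementary literals; without it the claim fails, e.g. F={{a,b,c},{¬a,¬b,¬c}} with rows (a,¬a),(b,¬b),(c,¬c), where L contains both {¬a} and {a}. *)

(* Defs.v *)
(* MathComp *)
From mathcomp Require Import all_boot all_fingroup.
From mathcomp Require Import matrix.

Set Implicit Arguments.
Unset Strict Implicit.
Unset Printing Implicit Defensive.

(* The variables live in a finite type V, of which Var(F) may be a proper
   subset.  (v, true) is the literal v and (v, false) its negation. *)
Notation lit V := (V * bool)%type.
Notation clause V := {set lit V}.
Notation cnf V := {set clause V}.

Definition neg_lit (V : finType) (l : lit V) : lit V := (l.1, ~~ l.2).

Definition vars (V : finType) (F : cnf V) : {set V} :=
  [set v | [exists C in F, [exists l in C, l.1 == v]]].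

(* Lit(F), closed under negation *)
Definition lits (V : finType) (F : cnf V) : {set lit V} :=
  [set l | l.1 \in vars F].

Definition satisfies (V : finType) (a : V -> bool) (F : cnf V) : Prop :=
  forall C : clause V, C \in F -> exists2 l, l \in C & a l.1 = l.2.

Definition satisfiable (V : finType) (F : cnf V) : Prop :=
  exists a : V -> bool, satisfies a F.

Definition equisatisfiable (V : finType) (F G : cnf V) : Prop :=
  satisfiable F <-> satisfiable G.

Definition unique_literal_clause (V : finType) (F : cnf V) (C : clause V) :
    Prop :=
  C \in F /\ forall D : clause V, D \in F :\ C -> [disjoint C & D].

(* A permutation of Lit(F) is encoded as a permutation of all the literals
   over V that moves only literals of Lit(F). *)
Definition syntactic_symmetry (V : finType) (F : cnf V) (s : {perm lit V}) :
    Prop :=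
  [/\ perm_on (lits F) s,
      [set s @: (C : clause V) | C in F] = F &
      forall l, l \in lits F -> s (neg_lit l) = neg_lit (s l)].

Definition row_symmetry (V : finType) (F : cnf V) (n m : nat)
    (M : 'M[lit V]_(n, m)) : Prop :=
  forall i1 i2 : 'I_n, exists2 s : {perm lit V}, syntactic_symmetry F s &
    (forall j, s (M i1 j) = M i2 j /\ s (M i2 j) = M i1 j) /\
    (forall i j, i != i1 -> i != i2 -> s (M i j) = M i j).

(* Literals extended with constants: inr true is \top, inr false is \bot. *)
Notation xlit V := (lit V + bool)%type.

Definition neg_xlit (V : finType) (x : xlit V) : xlit V :=
  match x with inl l => inl (neg_lit l) | inr b => inr (~~ b) end.

Definition subst_lit (V : finType) (w : V -> xlit V) (l : lit V) : xlit V :=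
  if l.2 then w l.1 else neg_xlit (w l.1).

(* Values outside Var(G) are irrelevant to the effect of w on G. *)
Definition substitution_on (V : finType) (G : cnf V) (w : V -> xlit V) : Prop :=
  forall v l, v \in vars G -> w v = inl l -> l \in lits G.

Definition subst_clause (V : finType) (w : V -> xlit V) (C : clause V) :
    clause V :=
  [set l | inl l \in [set subst_lit w x | x in C]].

Definition subst_cnf (V : finType) (w : V -> xlit V) (G : cnf V) : cnf V :=
  [set subst_clause w C | C in G & inr true \notin [set subst_lit w x | x in C]].

Definition neg_clause (V : finType) (C : clause V) : cnf V :=
  [set [set neg_lit l] | l in C].

Definition propagate (V : finType) (l : lit V) (G : cnf V) : cnf V :=
  [set C :\ neg_lit l | C : clause V in G & l \notin C].

(* G |-_1 \bot *)
Inductive up_conflict (V : finType) (G : cnf V) : Prop :=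
| up_empty of set0 \in G
| up_unit l of [set l] \in G & up_conflict (propagate l G).

Definition up_implies (V : finType) (G : cnf V) (D : clause V) : Prop :=
  up_conflict (G :|: neg_clause D).

Definition up_implies_cnf (V : finType) (G H : cnf V) : Prop :=
  forall D, D \in H -> up_implies G D.

Definition substitution_redundant (V : finType) (G : cnf V) (C : clause V) :
    Prop :=
  exists2 w : V -> xlit V, substitution_on (C |: G) w &
    up_implies_cnf (G :|: neg_clause C) (subst_cnf w (C |: G)).

Fixpoint SR_proof (V : finType) (F : cnf V) (Ds : seq (clause V)) : Prop :=
  if Ds is D :: Ds' then
    substitution_redundant F D /\ SR_proof (D |: F) Ds'
  else True.

Definition column_clause (V : finType) (n m : nat) (M : 'M[lit V]_(n, m))
    (j : 'I_m) : clause V :=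
  [set M i j | i : 'I_n].

(* Indices i : 'I_n, j : 'I_m start at 0, so they stand for row i.+1 and
   column j.+1. *)
Definition fixed_true (n m : nat) (i : 'I_n) (j : 'I_m) : bool :=
  (i.+1 == n) && (j.+1 == 1).

Definition fixed_false (n m : nat) (i : 'I_n) (j : 'I_m) : bool :=
  (j.+1 <= minn n m) && (i.+1 <= n - j.+1).

Definition orbitopal_fixing (V : finType) (n m : nat) (M : 'M[lit V]_(n, m)) :
    cnf V :=
  [set [set M p.1 p.2] | p : 'I_n * 'I_m & fixed_true p.1 p.2] :|:
  [set [set neg_lit (M p.1 p.2)] | p : 'I_n * 'I_m & fixed_false p.1 p.2].

Definition fixing_clause (V : finType) (n m : nat) (M : 'M[lit V]_(n, m))
    (i : 'I_n) (j : 'I_m) : option (clause V) :=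
  if fixed_true i j then Some [set M i j]
  else if fixed_false i j then Some [set neg_lit (M i j)]
  else None.

(* Columns from left to right; within each column, rows from top to bottom. *)
Definition orbitopal_sequence (V : finType) (n m : nat)
    (M : 'M[lit V]_(n, m)) : seq (clause V) :=
  flatten [seq pmap (fixing_clause M ^~ j) (enum 'I_n) | j <- enum 'I_m].

Lemma mem_orbitopal_sequence (V : finType) (n m : nat)
    (M : 'M[lit V]_(n, m)) : orbitopal_sequence M =i orbitopal_fixing M.
Proof.
have NF (i : 'I_n) (j : 'I_m) : fixed_false i j -> fixed_true i j = false.
  case/andP=> _ Hi; apply/negbTE/negP=> /andP[/eqP Ei _].
  have n_gt0 := leq_ltn_trans (leq0n i) (ltn_ord i).
  by move: Hi; rewrite Ei leqNgt ltn_subrL n_gt0.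
move=> C; rewrite /orbitopal_sequence inE; apply/flatten_mapP/orP.
  case=> j _; rewrite mem_pmap => /mapP[i _]; rewrite /fixing_clause.
  case: ifP => [Ht [->]|_]; first by left; apply/imsetP; exists (i, j); rewrite ?inE.
  by case: ifP => // Hf [->]; right; apply/imsetP; exists (i, j); rewrite ?inE.
case=> /imsetP[[i j]]; rewrite inE /= => H ->; exists j; rewrite ?mem_enum //;
  rewrite mem_pmap; apply/mapP; exists i; rewrite ?mem_enum // /fixing_clause.
  by rewrite H.
by rewrite NF // H.
Qed.

(* Pairwise distinct literals may still be complementary.  If two of the
   entries to be set to false are, the fixing is contradictory: take the rows
   (a, ~a), (b, ~b), (c, ~c) and F = {{a, b, c}, {~a, ~b, ~c}}, which is
   satisfiable, has row symmetry and has both columns as unique literal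
   clauses, while the unit clauses {~a} and {a} are both added. *)
Definition no_complementary_fixed (V : finType) (n m : nat)
    (M : 'M[lit V]_(n, m)) : Prop :=
  forall (i i' : 'I_n) (j j' : 'I_m),
    fixed_false i j -> fixed_false i' j' -> M i j <> neg_lit (M i' j').

(* Main.v *)
(* To fix the entry x in row i of column j to false, let y be the entry of column
   j in the first row r below the rows fixed to false in that column.  If x is
   true, then applying the symmetry s that swaps rows i and r makes y true, after
   which x can be set to false, because a literal of the unique literal clause of
   column j occurs positively in no other clause.  In the earlier columns both
   rows i and r are already fixed to false, so s respects the units added so far.
   The unit for the last row of the first column follows by unit propagation. *)

Require Import Defs.
From mathcomp Require Import all_boot all_fingroup.
From mathcomp Require Import matrix.
From mathcomp Require Import zify.

Set Implicit Arguments.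
Unset Strict Implicit.
Unset Printing Implicit Defensive.

(** * Literals, their variables and their negation *)

Section Literals.
Variable V : finType.
Implicit Types (l x y : lit V) (C D E : clause V) (F G H : cnf V).
Implicit Types (a : V -> bool) (w : V -> xlit V).

Lemma neg_litK : involutive (@neg_lit V).
Proof. by case=> v b; rewrite /neg_lit /= negbK. Qed.

Lemma neg_lit_neq l : neg_lit l != l.
Proof. by case: l => v b; rewrite /neg_lit xpair_eqE eqxx /=; case: b. Qed.

Lemma neg_xlitK : involutive (@neg_xlit V).
Proof. by case=> [l|b] /=; rewrite ?neg_litK ?negbK. Qed.

Lemma lit_var_eq l x : l.1 = x.1 -> l = x \/ l = neg_lit x.
Proof.
case: l x => v b [u c] /= ->; rewrite /neg_lit /=.
by case: b c => [] []; [left|right|right|left].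
Qed.

Lemma lits_clause C F l : C \in F -> l \in C -> l \in lits F.
Proof.
move=> CF lC; rewrite !inE; apply/existsP; exists C; rewrite CF.
by apply/existsP; exists l; rewrite lC /=.
Qed.

Lemma vars_witness v F :
  v \in vars F -> exists2 C, C \in F & exists2 l, l \in C & l.1 = v.
Proof.
rewrite inE => /existsP[C /andP[CF /existsP[l /andP[lC /eqP lv]]]].
by exists C => //; exists l.
Qed.

Lemma mem_lits F l : (l \in lits F) = (l.1 \in vars F).
Proof. by rewrite inE. Qed.

Lemma neg_lits F l : (neg_lit l \in lits F) = (l \in lits F).
Proof. by rewrite !mem_lits. Qed.

Lemma subst_lit_neg w l : subst_lit w (neg_lit l) = neg_xlit (subst_lit w l).
Proof. by rewrite /subst_lit /=; case: l.2; rewrite //= neg_xlitK. Qed.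

End Literals.

(** * Unit propagation, soundness of substitution redundancy, and two criteria for it *)

Section UnitPropagation.
Variable V : finType.
Implicit Types (l x y : lit V) (C D E : clause V) (F G H : cnf V).
Implicit Types (a : V -> bool) (w : V -> xlit V).

(** Induction on the size of [E]: propagating [neg_lit x] for one [x] in [E] removes [x] from [E]
    and keeps the other units. If [E] also contains [neg_lit x], two complementary units conflict at
    once. *)
Lemma falsified_up_conflict G E :
  E \in G -> (forall x, x \in E -> [set neg_lit x] \in G) -> up_conflict G.
Proof.
move Ek: #|E| => k; elim: k G E Ek => [|k IHk] G E Ek EG negE.
  by apply: up_empty; move/eqP: Ek; rewrite cards_eq0 => /eqP <-.
have /card_gt0P[x xE] : 0 < #|E| by rewrite Ek.
apply: (up_unit (negE _ xE)).
have [nxE|nxE] := boolP (neg_lit x \in E).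
  have xG : [set x] \in G by have := negE _ nxE; rewrite neg_litK.
  apply: up_empty; apply/imsetP; exists [set x].
    by rewrite inE xG in_set1 neg_lit_neq.
  by rewrite neg_litK setDv.
apply: (IHk _ (E :\ x)).
- by have := cardsD1 x E; rewrite xE Ek => -[].
- by apply/imsetP; exists E; rewrite ?inE ?EG ?neg_litK.
move=> y /setD1P[yx yE]; apply/imsetP; exists [set neg_lit y].
  by rewrite inE negE // in_set1 (inj_eq (inv_inj (@neg_litK V))) eq_sym.
rewrite neg_litK; apply/setP=> z; rewrite !inE.
have [->|//] := eqVneq z x; apply/negbTE.
by apply: contraNneq nxE => ->; rewrite neg_litK.
Qed.

Lemma up_conflict_unsat G a : up_conflict G -> ~ satisfies a G.
Proof.
elim=> {G} [G G0 /(_ _ G0)[l]|G l lG _ IH aG]; first by rewrite inE.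
apply: IH => _ /imsetP[C /setIdP[CG lC] ->].
have [x xC ax] := aG _ CG; exists x => //; rewrite !inE xC andbT.
have [y /set1P-> al] := aG _ lG.
by apply/eqP=> xl; move: ax; rewrite xl /= al; case: l.2.
Qed.

Lemma up_implies_sound G D a :
  up_implies G D -> satisfies a G -> exists2 l, l \in D & a l.1 = l.2.
Proof.
move=> GD aG; have [/existsP[l /andP[lD /eqP al]]|naD] :=
  boolP [exists l in D, a l.1 == l.2]; first by exists l.
case: (up_conflict_unsat (a := a) GD) => C /setUP[/aG //|/imsetP[l lD ->]].
exists (neg_lit l); rewrite ?inE //=.
move: naD; rewrite negb_exists => /forallP/(_ l); rewrite lD /=.
by case: (a _) l.2 => [] [].
Qed.

Definition subst_assignment a w v : bool :=
  match w v with inl l => a l.1 == l.2 | inr b => b end.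

Lemma subst_cnf_sound w G a :
  satisfies a (subst_cnf w G) -> satisfies (subst_assignment a w) G.
Proof.
move=> aG C CG.
have a'E l : subst_assignment a w l.1 = l.2 <->
    match subst_lit w l with inl x => a x.1 = x.2 | inr b => b end.
  rewrite /subst_assignment /subst_lit; case: l => v [].
    by case: (w v) => [[u b]|b] //=; split=> /eqP.
  by case: (w v) => [[u []]|[]] //=; case: (a u).
have [/imsetP[l lC lT]|nT] := boolP (inr true \in [set subst_lit w x | x in C]).
  by exists l => //; apply/a'E; rewrite -lT.
have /aG[x] : subst_clause w C \in subst_cnf w G.
  by apply/imsetP; exists C => //; rewrite inE CG.
by rewrite inE => /imsetP[l lC lx] ax; exists l => //; apply/a'E; rewrite -lx.
Qed.

(** An assignment falsifying [C] satisfies [G] and the negation of [C], hence, propagation being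
    sound, the substituted formula; composed with [w] it satisfies both [G] and [C]. *)
Lemma substitution_redundant_sat G C :
  substitution_redundant G C -> satisfiable G -> satisfiable (C |: G).
Proof.
case=> w _ Gw [a aG].
have [/existsP[l /andP[lC /eqP al]]|naC] := boolP [exists l in C, a l.1 == l.2].
  by exists a => D /setU1P[->|/aG //]; exists l.
exists (subst_assignment a w); apply: subst_cnf_sound => D /Gw GD.
apply: (up_implies_sound GD) => E /setUP[/aG //|/imsetP[l lC ->]].
exists (neg_lit l); rewrite ?inE //=.
move: naC; rewrite negb_exists => /forallP/(_ l); rewrite lC /=.
by case: (a _) l.2 => [] [].
Qed.

Lemma SR_proof_sat F (Ds : seq (clause V)) :
  SR_proof F Ds -> satisfiable F -> satisfiable (F :|: [set D in Ds]).
Proof.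
elim: Ds F => [|D Ds IH] F /=.
  by move=> _; rewrite set_nil setU0.
case=> SRD /IH IHD /(substitution_redundant_sat SRD)/IHD.
by rewrite set_cons setUCA setUA.
Qed.

(** Trades the recursion of [SR_proof] for a condition on each split of the list, in which the set
    of earlier clauses is explicit. *)
Lemma SR_proof_pmap (T : Type) (f : T -> option (clause V)) F (s : seq T) :
  (forall s1 p s2 C, s = s1 ++ p :: s2 -> f p = Some C ->
     substitution_redundant (F :|: [set D in pmap f s1]) C) ->
  SR_proof F (pmap f s).
Proof.
elim: s F => //= p s IH F SRs; case fp: (f p) => [C|] /=.
  split; first by have := SRs [::] p s C erefl fp; rewrite set_nil setU0.
  apply: IH => s1 q s2 D s_eq fq.
  have := SRs (p :: s1) q s2 D; rewrite s_eq /= fp /= set_cons.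
  by rewrite setUCA setUA; apply.
apply: IH => s1 q s2 D s_eq fq.
by have := SRs (p :: s1) q s2 D; rewrite s_eq /= fp; apply.
Qed.

(** When [G] and the negation of [C] already conflict, every clause is implied and any substitution
    serves; the identity introduces no foreign literals. *)
Lemma up_conflict_redundant G C :
  (forall H, up_conflict (G :|: neg_clause C :|: H)) ->
  substitution_redundant G C.
Proof.
move=> GC; exists (fun v => inl (v, true)) => [v l vG [<-]|D _]; last exact: GC.
by rewrite inE.
Qed.

(* Witness: s followed by x := false and y := true.  Making x false and y true
   can only hurt C, which y satisfies, and clauses D containing neg_lit y; for
   these, s D contains neg_lit x, which is falsified by the negation of
   [set neg_lit x]. *)
Lemma unique_swap_redundant F G C (s : {perm lit V}) x y :
  syntactic_symmetry F s -> unique_literal_clause F C ->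
  x \in C -> y \in C -> x != y -> s y = x -> F \subset G ->
  (forall D, D \in G -> D \in F \/ exists2 l, D = [set l] &
     [/\ l \in lits F, l != x, l != neg_lit y & l = y \/ [set s l] \in G]) ->
  substitution_redundant G [set neg_lit x].
Proof.
move=> [s_on sF s_neg] [CF C_ulc] xC yC xy sy FG Gunits.
pose w v : xlit V := if v == x.1 then inr (~~ x.2)
  else if v == y.1 then inr y.2 else inl (s (v, true)).
have wx : subst_lit w x = inr false.
  by rewrite /subst_lit /w eqxx; case: x.2.
have wnx : subst_lit w (neg_lit x) = inr true by rewrite subst_lit_neg wx.
have wy : subst_lit w y = inr true.
  (* The test for the variable of [x] comes first in [w]. If [y] shares that variable, then [y] is
     the negation of [x], and making [x] false makes [y] true. *)
  have [yx|yx] := eqVneq y.1 x.1.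
    by have [yEx|-> //] := lit_var_eq yx; rewrite yEx eqxx in xy.
  by rewrite /subst_lit /w (negbTE yx) eqxx; case: y.2.
have wny : subst_lit w (neg_lit y) = inr false by rewrite subst_lit_neg wy.
have ws l : l \in lits F -> l != x -> l != y -> l != neg_lit x ->
    l != neg_lit y -> subst_lit w l = inl (s l).
  move=> lF lx ly lnx lny; rewrite /subst_lit /w.
  have -> : (l.1 == x.1) = false.
    by apply/eqP=> /lit_var_eq[] /eqP; apply/negP.
  have -> : (l.1 == y.1) = false.
    by apply/eqP=> /lit_var_eq[] /eqP; apply/negP.
  case: l lF {lx ly lnx lny} => v [] //= lF.
  by rewrite -s_neg /neg_lit //= -neg_lits.
have xF : x \in lits F := lits_clause CF xC.
have yF : y \in lits F := lits_clause CF yC.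
(* The extra units lie over [lits F], so the enlarged formula has the variables of [F], and [s]
   keeps [w] inside its literals. *)
have GF v : v \in vars ([set neg_lit x] |: G) -> v \in vars F.
  case/vars_witness=> D /setU1P[->|/Gunits[DF|[l -> [lF _ _ _]]]] [z zD <-].
  - by move/set1P: zD => ->; rewrite mem_lits in xF.
  - by have := lits_clause DF zD; rewrite mem_lits.
  - by move/set1P: zD => ->; rewrite mem_lits in lF.
have FG' v : v \in vars F -> v \in vars ([set neg_lit x] |: G).
  case/vars_witness=> D DF [z zD <-].
  have DG : D \in [set neg_lit x] |: G by rewrite inE (subsetP FG) ?orbT.
  by have := lits_clause DG zD; rewrite mem_lits.
exists w => [v l /GF vF|].
  rewrite /w; case: ifP => // _; case: ifP => // _ [<-].
  by rewrite mem_lits; apply: FG'; rewrite -mem_lits (perm_closed _ s_on) mem_lits.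
have notC D z : D \in F -> z \in C -> z \in D -> D = C.
  move=> DF zC zD; apply/eqP/negPn/negP=> DC.
  have /C_ulc : D \in F :\ C by rewrite !inE DC.
  by move/pred0P/(_ z) => /=; rewrite zC zD.
have nxx : [set neg_lit (neg_lit x)] \in neg_clause [set neg_lit x].
  by apply/imsetP; exists (neg_lit x); rewrite ?inE.
move=> _ /imsetP[D /setIdP[DG nT] ->].
(* Clauses with a literal sent to true are deleted, so a surviving [D] contains neither [neg_lit x]
   nor [y]. *)
have nTl l : l \in D -> subst_lit w l <> inr true.
  by move=> lD lT; case/negP: nT; apply/imsetP; exists l.
have nxD : neg_lit x \notin D by apply/negP=> /nTl; rewrite wnx.
have yD : y \notin D by apply/negP=> /nTl; rewrite wy.
have subst_mem l : l \in D -> l \in lits F -> l != x -> l != neg_lit y ->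
    s l \in subst_clause w D.
  move=> lD lF lx lny; rewrite inE; apply/imsetP; exists l => //.
  rewrite ws //; first by apply: contraNneq yD => <-.
  by apply: contraNneq nxD => <-.
have neg_mem l H : l \in subst_clause w D ->
    [set neg_lit l] \in H :|: neg_clause (subst_clause w D).
  by move=> lD; rewrite inE; apply/orP; right; apply/imsetP; exists l.
have [DE|DG'] : D = [set neg_lit x] \/ D \in G by apply/setU1P.
  by rewrite DE inE eqxx in nxD.
have [DF|[l DE [lF lx lny [ly|slG]]]] := Gunits _ DG'; last first.
- apply: (@falsified_up_conflict _ [set s l]); first by rewrite !inE slG.
  by move=> _ /set1P->; apply/neg_mem/subst_mem => //; rewrite DE inE.
- by rewrite DE ly inE eqxx in yD.
have xD : x \notin D.
  by apply: contraNN yD => xD; rewrite (notC _ _ DF xC xD).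
apply: (@falsified_up_conflict _ (s @: D)).
  by rewrite !inE (subsetP FG) // -sF; apply/imsetP; exists D.
move=> _ /imsetP[l lD ->]; have lF := lits_clause DF lD.
have [->|lny] := eqVneq l (neg_lit y).
  by rewrite s_neg // sy inE inE nxx orbT.
by apply/neg_mem/subst_mem => //; apply: contraNneq xD => <-.
Qed.

End UnitPropagation.

(** * The order of the additions, and the redundancy of each unit *)

Definition column_major_lt (n m : nat) (p q : 'I_n * 'I_m) : bool :=
  (p.2 < q.2) || (p.2 == q.2) && (p.1 < q.1).

(** Serves to identify the part of the list before an entry with the set of its predecessors. *)
Lemma pairwise_column_major_lt (n m : nat) :
  pairwise (@column_major_lt n m) [seq (i, j) | j <- enum 'I_m, i <- enum 'I_n].
Proof.
have pairwise_ltn k : pairwise (fun i i' : 'I_k => i < i') (enum 'I_k).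
  rewrite -(pairwise_map val ltn) val_enum_ord -sorted_pairwise ?iota_ltn_sorted //.
  exact: ltn_trans.
elim: (enum 'I_m) (pairwise_ltn m) => //= j s IH /andP[js /IH ps].
rewrite pairwise_cat ps andbT; apply/andP; split.
  apply/allrelP=> _ _ /mapP[i _ ->] /allpairsP[[j' i'] /= [j's _ ->]].
  by rewrite /column_major_lt /= (allP js).
rewrite pairwise_map; apply: sub_pairwise (pairwise_ltn n) => i i' /= ii'.
by rewrite /column_major_lt /= eqxx ii' orbT.
Qed.

Lemma orbitopal_sequenceE (V : finType) (n m : nat) (M : 'M[lit V]_(n, m)) :
  orbitopal_sequence M = pmap (fun p => fixing_clause M p.1 p.2)
    [seq (i, j) | j <- enum 'I_m, i <- enum 'I_n].
Proof.
rewrite /orbitopal_sequence; elim: (enum 'I_m) => //= j s ->.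
by rewrite pmap_cat; congr cat; elim: (enum 'I_n) => //= i t ->.
Qed.

(** [G] is [F] with the units of all entries before [(i, j)]. For an entry fixed to false, the point
    is that [s] maps these units to units of [G], as [unique_swap_redundant] requires. *)
Lemma fixing_clause_redundant (V : finType) (F : cnf V) (n m : nat)
    (M : 'M[lit V]_(n, m)) (G : cnf V) (i : 'I_n) (j : 'I_m) (C : clause V) :
  (forall i j, M i j \in lits F) ->
  injective (fun p : 'I_n * 'I_m => M p.1 p.2) ->
  no_complementary_fixed M -> row_symmetry F M ->
  (forall j, unique_literal_clause F (column_clause M j)) ->
  (forall D, D \in G <-> D \in F \/ exists2 p, column_major_lt p (i, j) &
     fixing_clause M p.1 p.2 = Some D) ->
  fixing_clause M i j = Some C -> substitution_redundant G C.
Proof.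
move=> M_lits M_inj M_compl M_sym M_ulc GE.
rewrite /fixing_clause; case: ifP => [/andP[/eqP i_last /eqP j0] [<-]|_].
  apply: up_conflict_redundant => H.
  (* All other entries of the first column are already fixed to false, so its clause is falsified
     once [M i j] is negated. *)
  apply: (@falsified_up_conflict _ _ (column_clause M j)).
    rewrite !inE; apply/orP; left; apply/orP; left.
    by apply/GE; left; case: (M_ulc j).
  move=> _ /imsetP[k _ ->]; have [->|ki] := eqVneq k i.
    rewrite inE inE; apply/orP; left; apply/orP; right.
    by apply/imsetP; exists (M i j); rewrite ?inE.
  rewrite inE inE; apply/orP; left; apply/orP; left; apply/GE; right.
  have k_lt : k < i by have := ltn_ord k; move: ki; rewrite -val_eqE /=; lia.
  have k_f : fixed_false k j.
    by have := ltn_ord j; have := ltn_ord k; rewrite /fixed_false; lia.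
  exists (k, j); first by rewrite /column_major_lt /= eqxx k_lt orbT.
  rewrite /fixing_clause /= k_f ifF //; apply/negP=> /andP[/eqP]; lia.
case: ifP => // ij_f [<-].
(* With rows counted from 0, column [j] is fixed to false exactly in the rows below index
   [n - j.+1]. *)
have r_lt : n - j.+1 < n by have := ltn_ord i; move/andP: ij_f; lia.
pose r := Ordinal r_lt.
have ir : i < r by move/andP: ij_f => /=; lia.
have ri : i != r by rewrite -val_eqE /= neq_ltn ir.
have [s s_sym [s_swap s_fix]] := M_sym i r.
have [_ _ s_neg] := s_sym.
apply: (unique_swap_redundant s_sym (M_ulc j) (x := M i j) (y := M r j)).
- exact: imset_f.
- exact: imset_f.
- by apply/eqP=> /(M_inj (i, j) (r, j)) [] /eqP; rewrite (negbTE ri).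
- by case: (s_swap j).
- by apply/subsetP=> D DF; apply/GE; left.
move=> D /GE[|[[k l] kl_lt]]; first by left.
rewrite /fixing_clause /=; case: ifP => [kl_t [<-]|kl_t].
  (* The last row cannot precede row [i] within a column, so [j] is not the first column. Then [r]
     lies above the last row, and [s] fixes [M k l]. *)
  have /andP[/eqP k_last /eqP l0] := kl_t.
  have jl : l < j.
    by move: kl_lt; rewrite /column_major_lt /= -val_eqE /=; have := ltn_ord i; lia.
  have rk : r < k by move: ir => /=; lia.
  have s_kl : s (M k l) = M k l.
    by apply: s_fix; rewrite -val_eqE /= neq_ltn (ltn_trans ir rk, rk) orbT.
  right; exists (M k l) => //; split=> //.
  - by apply/eqP=> /(M_inj (k, l) (i, j)) [_ lj]; rewrite lj ltnn in jl.
    (* If M k l were complementary to M r j, then s, fixing M k l, would fix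
       M r j instead of mapping it to M i j. *)
  - apply/eqP=> E; move: (s_kl); rewrite E s_neg //; case: (s_swap j) => _ ->.
    move=> /(inv_inj (@neg_litK V)) /(M_inj (i, j) (r, j)) [] /eqP.
    by rewrite (negbTE ri).
  - right; rewrite s_kl; apply/GE; right.
    by exists (k, l); rewrite //= /fixing_clause kl_t.
case: ifP => // kl_f [<-]; right; exists (neg_lit (M k l)) => //; split.
- by rewrite neg_lits.
(* An earlier unit equal to [M i j] would come from an entry complementary to [M i j], both fixed to
   false. *)
- by apply/eqP=> E; apply: (M_compl i k j l) => //; rewrite E.
- apply/eqP=> /(inv_inj (@neg_litK V)) /(M_inj (k, l) (r, j)) [kr lj].
  by move: kl_lt; rewrite /column_major_lt /= lj ltnn eqxx /= kr; lia.
right; rewrite s_neg //.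
have unitG k' : fixed_false k' l -> column_major_lt (k', l) (i, j) ->
    [set neg_lit (M k' l)] \in G.
  move=> k'_f k'_lt; apply/GE; right; exists (k', l) => //.
  rewrite /fixing_clause /= k'_f ifF //; apply/negP=> /andP[/eqP k'_last _].
  by move: k'_f; rewrite /fixed_false; lia.
have lj_lt : i <= k -> l < j.
  by case/orP: kl_lt => [//|/andP[_ /= ki]]; rewrite leqNgt ki.
(* Each column further left has at least one more row fixed to false, so in column [l] this includes
   row [r]. *)
have unit_earlier (k' : 'I_n) : k' <= r -> l < j -> [set neg_lit (M k' l)] \in G.
  move=> k'r lj; apply: unitG; last by rewrite /column_major_lt /= lj.
  by move: ij_f k'r; rewrite /fixed_false /=; have := ltn_ord i; lia.
have [ki|ki] := eqVneq k i.
  have [sM _] := s_swap l; rewrite ki sM; apply: unit_earlier => //.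
  by apply: lj_lt; rewrite ki.
have [kr|kr] := eqVneq k r.
  have [_ sM] := s_swap l; rewrite kr sM; apply: unit_earlier; first exact: ltnW ir.
  by apply: lj_lt; rewrite kr ltnW.
by rewrite s_fix //; apply: unitG.
Qed.

Theorem theorem1 (V : finType) (F : cnf V) (n m : nat) (M : 'M[lit V]_(n, m))
    (n_gt0 : 0 < n) (m_gt0 : 0 < m)
    (M_lits : forall (i : 'I_n) (j : 'I_m), M i j \in lits F)
    (M_distinct : injective (fun p : 'I_n * 'I_m => M p.1 p.2))
    (M_compl : no_complementary_fixed M)
    (M_sym : row_symmetry F M)
    (M_ulc : forall j : 'I_m, unique_literal_clause F (column_clause M j)) :
  equisatisfiable F (F :|: orbitopal_fixing M) /\
  SR_proof F (orbitopal_sequence M).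
Proof.
have SR : SR_proof F (orbitopal_sequence M).
  rewrite orbitopal_sequenceE; apply: SR_proof_pmap => s1 [i j] s2 C s_eq.
  apply: fixing_clause_redundant M_lits M_distinct M_compl M_sym M_ulc _ => D.
  (* As the list is ordered and contains every pair, [s1] consists of exactly the predecessors of
     [(i, j)]. *)
  have := pairwise_column_major_lt n m; rewrite s_eq pairwise_cat.
  case/and3P=> /allrelP s1_lt _ /= /andP[/allP s2_gt _].
  rewrite !inE mem_pmap; split=> [/orP[DF|/mapP[p ps1 ->]]|[->//|[p p_lt pD]]].
  - by left.
  - by right; exists p => //; rewrite s1_lt ?mem_head.
  apply/orP; right; apply/mapP; exists p => //.
  have : p \in [seq (i, j) | j <- enum 'I_m, i <- enum 'I_n].
    by case: p {p_lt pD} => k l; apply/allpairsP; exists (l, k); rewrite !mem_enum.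
  rewrite s_eq mem_cat inE => /or3P[//|/eqP pE|/s2_gt]; move: p_lt.
    by rewrite pE /column_major_lt /= !ltnn eqxx.
  by rewrite /column_major_lt -!val_eqE /=; lia.
(* Part (1) follows from part (2), since an SR proof preserves satisfiability; conversely [F] is a
   subset of the extended formula. *)
split=> //; split=> [satF|[a aFL]]; last first.
  by exists a => C CF; apply: aFL; rewrite inE CF.
have := SR_proof_sat SR satF.
by congr (satisfiable (F :|: _)); apply/setP=> D; rewrite inE mem_orbitopal_sequence.
Qed.
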